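(* Under Assumptions 1, 2 and 3 of the context, for any $(x_1,y_1),(x_2,y_2)\in\mathbb{R}^{d_{\sf up}}\times\mathbb{R}^{d_{\sf lo}}$, the stochastic gradient estimate $\bar\nabla f(x,y;\bar\xi)$ defined in the context satisfies $$\mathbb{E}_{\bar\xi}\big\|\bar\nabla f(x_1,y_1;\bar\xi)-\bar\nabla f(x_2,y_2;\bar\xi)\big\|^2\le L_K^2\big\{\|x_1-x_2\|+\|y_1-y_2\|\big\}^2,$$ where $$L_K=\sqrt{2L_{f_x}^2+\frac{6C_{g_{xy}}^2L_{f_y}^2K}{2\mu_gL_g-\mu_g^2}+\frac{6C_{f_y}^2L_{g_{xy}}^2K}{2\mu_gL_g-\mu_g^2}+\frac{6C_{g_{xy}}^2C_{f_y}^2L_{g_{yy}}^2K^3}{(L_g-\mu_g)^2(2\mu_gL_g-\mu_g^2)}}$$ and $K$ is the number of samples used to construct the estimate.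
   Context: $f(x,y)=\mathbb{E}_{\xi\sim\pi_f}[f(x,y;\xi)]$ and $g(x,y)=\mathbb{E}_{\zeta\sim\pi_g}[g(x,y;\zeta)]$ are functions on $\mathbb{R}^{d_{\sf up}}\times\mathbb{R}^{d_{\sf lo}}$. Norms are Euclidean for vectors and the induced operator norm for matrices. Assumption 1 (upper level). $\nabla_xf$ and $\nabla_yf$ are Lipschitz in $(x,y)$ with constants $L_{f_x},L_{f_y}\ge0$; $\|\nabla_yf(x,y)\|\le C_{f_y}$ for all $(x,y)$. Assumption 2 (lower level). $g$ is twice continuously differentiable; $\nabla_yg$ is $L_g$-Lipschitz in $(x,y)$; $g(x,\cdot)$ is $\mu_g$-strongly convex with $\mu_g>0$ for every $x$; $\nabla^2_{xy}g$ and $\nabla^2_{yy}g$ are Lipschitz in $(x,y)$ with constants $L_{g_{xy}},L_{g_{yy}}\ge0$; $\|\nabla^2_{xy}g(x,y)\|\le C_{g_{xy}}$ for all $(x,y)$, with $C_{g_{xy}}>0$. Assumption 3. Assumptions 1 and 2 hold, with the same constants, for $f(\cdot,\cdot;\xi)$ and $g(\cdot,\cdot;\zeta)$ for all $\xi\in\mathrm{supp}(\pi_f)$, $\zeta\in\mathrm{supp}(\pi_g)$. Stochastic estimator with parameter $K\in\mathbb{N}$, $K\ge1$: draw independent $\bar\xi=\{\xi,\zeta^{(0)},\dots,\zeta^{(K)},\mathsf{k}\}$ with $\xi\sim\pi_f$, $\zeta^{(i)}\sim\pi_g$, $\mathsf{k}$ uniform on $\{0,\dots,K-1\}$, and set $$\bar\nabla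 f(x,y;\bar\xi)=\nabla_xf(x,y;\xi)-\frac{K}{L_g}\nabla^2_{xy}g(x,y;\zeta^{(0)})\prod_{i=1}^{\mathsf{k}}\Big(I-\frac{\nabla^2_{yy}g(x,y;\zeta^{(i)})}{L_g}\Big)\nabla_yf(x,y;\xi),$$ where the empty product is $I$. It is implicit that $L_g>\mu_g$, so that $L_K$ is well defined. *)

(* Defs.v *)
(* Mathematical Components / MathComp-Analysis. *)
From HB Require Import structures.
From mathcomp Require Import all_boot all_order all_algebra.
From mathcomp Require Import all_classical all_reals all_analysis.

Set Implicit Arguments.
Unset Strict Implicit.
Unset Printing Implicit Defensive.

Import Order.TTheory GRing.Theory Num.Theory.
Import numFieldNormedType.Exports.

Local Open Scope classical_set_scope.
Local Open Scope ring_scope.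

(* The norm that the library puts on 'cV[R]_n and on products is the sup norm.
   It serves below only to express differentiability and continuity, which do
   not depend on the norm in finite dimension; every quantitative bound uses
   [enorm] and [opnorm]. *)
Definition enorm (R : realType) (n : nat) (v : 'cV[R]_n) : R :=
  Num.sqrt (\sum_i v i 0 ^+ 2).

Definition opnorm (R : realType) (m n : nat) (A : 'M[R]_(m, n)) : R :=
  sup [set enorm (A *m v) | v in [set v : 'cV[R]_n | enorm v <= 1]].

Section Calculus.
Variables (R : realType) (m n : nat).
Implicit Types (h : 'cV[R]_m * 'cV[R]_n -> R) (p q : 'cV[R]_m * 'cV[R]_n).

Definition evx (i : 'I_m) : 'cV[R]_m * 'cV[R]_n := (delta_mx i 0, 0).
Definition evy (j : 'I_n) : 'cV[R]_m * 'cV[R]_n := (0, delta_mx j 0).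

Definition gradx h p : 'cV[R]_m := \col_i 'D_(evx i) h p.
Definition grady h p : 'cV[R]_n := \col_j 'D_(evy j) h p.

Definition hessxy h p : 'M[R]_(m, n) :=
  \matrix_(i, j) 'D_(evx i) ('D_(evy j) h) p.
Definition hessyy h p : 'M[R]_n :=
  \matrix_(i, j) 'D_(evy i) ('D_(evy j) h) p.

Definition lipschitz_wrt (V : zmodType) (N : V -> R) (L : R)
    (F : 'cV[R]_m * 'cV[R]_n -> V) : Prop :=
  forall p q, N (F p - F q) <= L * enorm (col_mx (p.1 - q.1) (p.2 - q.2)).

Definition twice_continuously_differentiable h : Prop :=
  [/\ forall p, differentiable h p,
      forall v p, differentiable ('D_v h) p
    & forall u v, continuous ('D_u ('D_v h))].

Definition strongly_convex (mu : R) (phi : 'cV[R]_n -> R) : Prop :=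
  forall (y1 y2 : 'cV[R]_n) (t : R), 0 <= t <= 1 ->
    phi (t *: y1 + (1 - t) *: y2) <=
    t * phi y1 + (1 - t) * phi y2
    - mu / 2 * t * (1 - t) * enorm (y1 - y2) ^+ 2.

Record upper_level_assumption (Lfx Lfy Cfy : R) (f : 'cV[R]_m * 'cV[R]_n -> R)
    : Prop := {
  upper_diff : forall p, differentiable f p;
  upper_gradx_lip : lipschitz_wrt (@enorm R m) Lfx (gradx f);
  upper_grady_lip : lipschitz_wrt (@enorm R n) Lfy (grady f);
  upper_grady_bound : forall p, enorm (grady f p) <= Cfy }.

Record lower_level_assumption (Lg mug Lgxy Lgyy Cgxy : R)
    (g : 'cV[R]_m * 'cV[R]_n -> R) : Prop := {
  lower_C2 : twice_continuously_differentiable g;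
  lower_grady_lip : lipschitz_wrt (@enorm R n) Lg (grady g);
  lower_strongly_convex : forall x, strongly_convex mug (fun y => g (x, y));
  lower_hessxy_lip : lipschitz_wrt (@opnorm R m n) Lgxy (hessxy g);
  lower_hessyy_lip : lipschitz_wrt (@opnorm R n n) Lgyy (hessyy g);
  lower_hessxy_bound : forall p, opnorm (hessxy g p) <= Cgxy }.

(* [zeta] lists the K+1 lower-level samples; inord reindexes 1 <= i <= k < K
   into 'I_K.+1.  The factors are matrices, so the order of the product
   (increasing i, from left to right) matters. *)
Definition stochastic_gradient (Xi Z : Type) (K : nat) (Lg : R)
    (f : Xi -> 'cV[R]_m * 'cV[R]_n -> R) (g : Z -> 'cV[R]_m * 'cV[R]_n -> R)
    (p : 'cV[R]_m * 'cV[R]_n) (xi : Xi) (zeta : 'I_K.+1 -> Z) (k : nat)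
    : 'cV[R]_m :=
  gradx (f xi) p
  - (K%:R / Lg) *:
    (hessxy (g (zeta ord0)) p
     *m (\prod_(1 <= i < k.+1) (1%:M - Lg^-1 *: hessyy (g (zeta (inord i))) p))
     *m grady (f xi) p).

End Calculus.

Definition LK (R : realType) (K : nat)
    (Lfx Lfy Cfy Lg mug Lgxy Lgyy Cgxy : R) : R :=
  Num.sqrt
    (2 * Lfx ^+ 2
     + (6 * Cgxy ^+ 2 * Lfy ^+ 2 * K%:R) / (2 * mug * Lg - mug ^+ 2)
     + (6 * Cfy ^+ 2 * Lgxy ^+ 2 * K%:R) / (2 * mug * Lg - mug ^+ 2)
     + (6 * Cgxy ^+ 2 * Cfy ^+ 2 * Lgyy ^+ 2 * K%:R ^+ 3)
       / ((Lg - mug) ^+ 2 * (2 * mug * Lg - mug ^+ 2))).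

Notation borel T := (g_sigma_algebraType (@open T)).

Definition supp (R : realType) (T : ptopologicalType)
    (mu : probability (borel T) R) : set T :=
  [set t | forall U : set T, open U -> U t -> (0 < mu U)%E].

Definition mean (R : realType) (T : ptopologicalType) (V : Type)
    (mu : probability (borel T) R) (h : T -> V -> R) (p : V) : R :=
  fine 'E_mu[fun t : borel T => h t p].

(* Mutual independence is the product rule for the whole finite family of
   events; taking some of them to be the full space gives the subfamilies. *)
Record sampling (R : realType) (Xi Z : ptopologicalType)
    (pif : probability (borel Xi) R) (pig : probability (borel Z) R) (K : nat)
    (d : measure_display) (Omega : measurableType d) (P : probability Omega R)
    (xi : {RV P >-> borel Xi}) (zeta : 'I_K.+1 -> {RV P >-> borel Z})
    (k : {RV P >-> nat}) : Prop := {
  sampling_xi : forall A : set (borel Xi), measurable A ->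
    distribution P xi A = pif A;
  sampling_zeta : forall (i : 'I_K.+1) (B : set (borel Z)), measurable B ->
    distribution P (zeta i) B = pig B;
  sampling_k : forall j : nat, (j < K)%N ->
    distribution P k [set j] = (K%:R^-1)%:E;
  sampling_indep : forall (A : set (borel Xi)) (B : 'I_K.+1 -> set (borel Z))
      (C : set nat), measurable A -> (forall i, measurable (B i)) ->
    P (xi @^-1` A `&` \bigcap_i (zeta i @^-1` B i) `&` k @^-1` C) =
    (P (xi @^-1` A) * (\prod_i P (zeta i @^-1` B i)) * P (k @^-1` C))%E }.

(* Main.v *)
Require Import Defs.
From HB Require Import structures.
From mathcomp Require Import all_boot all_order all_algebra.
From mathcomp Require Import all_classical all_reals all_analysis.
From mathcomp Require Import measurable_realfun ring lra.
Set Implicit Arguments.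
Unset Strict Implicit.
Unset Printing Implicit Defensive.
Import Order.TTheory GRing.Theory Num.Theory.
Import numFieldNormedType.Exports.
Local Open Scope classical_set_scope.
Local Open Scope ring_scope.

(** Fix the samples and the value k = j.  At every point of the support, g is
    C^2 and strongly convex in y with a Lipschitz gradient, so hessyy g is a
    symmetric matrix with spectrum in [mug, Lg], and I - hessyy g / Lg has norm
    at most r = 1 - mug / Lg < 1 ([opnorm_sub_hessyy]).  Symmetry turns the
    bounds on the quadratic form into a bound on the norm with the same constant
    ([sym_enorm_mulmx]); it comes from the equality of mixed second derivatives
    ([derive2C]).

    A product of j such factors has norm at most r^j, and moving the base point
    changes it by at most j r^(j-1) Lgyy / Lg times the displacement
    ([opnorm_prodB]).  Telescoping the triple product
    hessxy g * product * grady f therefore gives a pathwise Lipschitz bound whose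
    squared constant depends on j only ([stochastic_gradient_lipschitz]).

    It remains to average over k, uniform on {0, .., K - 1}.  The bounds
    sum_j r^(2j) <= 1 / (1 - r^2) = Lg^2 / (2 mug Lg - mug^2) and
    j r^(j-1) <= K r^j / r turn the average into LK^2
    ([mean_pathwise_lip2_le]).

    The pathwise bound holds almost surely only, because the assumptions
    concern points of the supports; in a second countable space the support
    has full measure ([negligible_setC_supp]).  The estimator is not assumed to be
    measurable in the samples, so the expectation is bounded through a measurable
    majorant that is a function of k alone ([expectation_le_uniform]). *)

(** * Euclidean and operator norms *)

Lemma discriminant_le (R : realType) (a b c : R) : 0 <= c ->
  (forall t, 0 <= a + 2 * b * t + c * t ^+ 2) -> b ^+ 2 <= a * c.
Proof.
move=> c_ge0 h; have [c0|c0] := eqVneq c 0.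
  have [->|b0] := eqVneq b 0; first by rewrite c0 mulr0 expr0n.
  (* An affine function that takes the value -1 here. *)
  have := h (- (a + 1) / (2 * b)); rewrite c0 mul0r addr0.
  rewrite mulrCA divff ?mulr1; first by lra.
  by rewrite mulf_neq0// pnatr_eq0.
have cp : 0 < c by rewrite lt_neqAle eq_sym c0.
have := h (- b / c).
have -> : a + 2 * b * (- b / c) + c * (- b / c) ^+ 2 = (a * c - b ^+ 2) / c.
  by field.
by rewrite pmulr_lge0 ?invr_gt0// subr_ge0.
Qed.

Definition dot (R : realType) (n : nat) (u v : 'cV[R]_n) : R :=
  \sum_i u i 0 * v i 0.

Section EuclideanNorm.
Variables (R : realType) (n : nat).
Implicit Types (u v w : 'cV[R]_n) (B : 'M[R]_n) (c : R).

Lemma dotC u v : dot u v = dot v u.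
Proof. by apply: eq_bigr => i _; rewrite mulrC. Qed.

Lemma dotDl u v w : dot (u + v) w = dot u w + dot v w.
Proof. by rewrite -big_split; apply: eq_bigr => i _; rewrite mxE mulrDl. Qed.

Lemma dotZl c u w : dot (c *: u) w = c * dot u w.
Proof. by rewrite mulr_sumr; apply: eq_bigr => i _; rewrite mxE mulrA. Qed.

Lemma dotDr u v w : dot w (u + v) = dot w u + dot w v.
Proof. by rewrite dotC dotDl !(dotC w). Qed.

Lemma dotZr c u w : dot w (c *: u) = c * dot w u.
Proof. by rewrite dotC dotZl dotC. Qed.

Lemma dotBr u v w : dot w (u - v) = dot w u - dot w v.
Proof. by rewrite -scaleN1r dotDr dotZr mulN1r. Qed.

Lemma dot_trmx B u v : dot u (B *m v) = dot (B^T *m u) v.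
Proof.
rewrite /dot; under eq_bigr do rewrite mxE mulr_sumr.
rewrite exchange_big; apply: eq_bigr => j _; rewrite mxE mulr_suml.
by apply: eq_bigr => i _; rewrite mxE mulrCA mulrA.
Qed.

Lemma dot_ge0 v : 0 <= dot v v.
Proof. by apply: sumr_ge0 => i _; rewrite -expr2 sqr_ge0. Qed.

Lemma enorm_ge0 v : 0 <= enorm v. Proof. exact: sqrtr_ge0. Qed.

Lemma sqr_enorm v : enorm v ^+ 2 = dot v v.
Proof.
rewrite sqr_sqrtr; last by apply: sumr_ge0 => i _; rewrite sqr_ge0.
by apply: eq_bigr => i _; rewrite expr2.
Qed.

Lemma enorm_le v c : 0 <= c -> (enorm v <= c) = (dot v v <= c ^+ 2).
Proof. by move=> c0; rewrite -sqr_enorm ler_pXn2r// nnegrE// enorm_ge0. Qed.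

Lemma enorm0 : enorm (0 : 'cV[R]_n) = 0.
Proof.
by rewrite /enorm big1 ?sqrtr0// => i _; rewrite mxE expr0n.
Qed.

Lemma enorm_eq0 v : enorm v = 0 -> v = 0.
Proof.
move=> v0; have := sqr_enorm v; rewrite v0 expr0n/= => /esym/eqP.
rewrite psumr_eq0 => [/allP h|i _]; last by rewrite -expr2 sqr_ge0.
apply/colP => i; rewrite mxE; apply/eqP.
by have := h i; rewrite mem_index_enum -expr2 sqrf_eq0 => /(_ isT).
Qed.

Lemma enormZ c v : enorm (c *: v) = `|c| * enorm v.
Proof.
apply/eqP; rewrite -(@eqrXn2 _ 2)// ?mulr_ge0 ?enorm_ge0//.
by rewrite exprMn !sqr_enorm dotZl dotZr mulrA -expr2 real_normK// num_real.
Qed.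

Lemma enormN v : enorm (- v) = enorm v.
Proof. by rewrite -scaleN1r enormZ normrN1 mul1r. Qed.

(** The Cauchy-Schwarz inequality for a possibly degenerate form: the
    discriminant of t |-> <u + t v, B (u + t v)> >= 0. *)
Lemma psd_cauchy_schwarz B u v : B^T = B ->
  (forall w, 0 <= dot w (B *m w)) ->
  dot u (B *m v) ^+ 2 <= dot u (B *m u) * dot v (B *m v).
Proof.
move=> sB B0; apply: discriminant_le => // t.
have := B0 (u + t *: v).
rewrite mulmxDr -scalemxAr !dotDl !dotDr !dotZl !dotZr.
rewrite (dot_trmx B v u) sB (dotC (B *m v)).
by congr (_ <= _); ring.
Qed.

Lemma cauchy_schwarz u v : dot u v <= enorm u * enorm v.
Proof.
have := @psd_cauchy_schwarz 1%:M u v (trmx1 _ _).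
rewrite !mul1mx -!sqr_enorm -exprMn => h.
have {}h := h (fun w => _); apply: (le_trans (ler_norm _)).
rewrite -(@ler_pXn2r _ 2)// ?nnegrE ?mulr_ge0 ?enorm_ge0//.
by rewrite real_normK ?num_real// h// => w; rewrite mul1mx dot_ge0.
Qed.

Lemma enormD u v : enorm (u + v) <= enorm u + enorm v.
Proof.
rewrite enorm_le ?addr_ge0 ?enorm_ge0// sqrrD !sqr_enorm.
rewrite !dotDl !dotDr (dotC v u).
have := cauchy_schwarz u v; lra.
Qed.

(** A symmetric form with values in [0, c] on unit vectors has norm at most c:
    Cauchy-Schwarz for the form itself, tested on v and B v, gives
    |B v|^4 <= <v, B v> <B v, B (B v)>. *)
Lemma sym_enorm_mulmx B c v : 0 <= c -> B^T = B ->
  (forall w, 0 <= dot w (B *m w) <= c * dot w w) ->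
  enorm (B *m v) <= c * enorm v.
Proof.
move=> c0 sB h.
have B0 w : 0 <= dot w (B *m w) by have /andP[] := h w.
have := @psd_cauchy_schwarz B (B *m v) v sB B0.
have /andP[h1 h2] := h v; have /andP[h3 h4] := h (B *m v).
rewrite enorm_le ?mulr_ge0 ?enorm_ge0// exprMn sqr_enorm.
set N := dot (B *m v) (B *m v) in h4 *.
have N0 : 0 <= N by exact: dot_ge0.
have v0 := dot_ge0 v.
move: N0; rewrite le_eqVlt => /predU1P[<- _|Np h5].
  by rewrite mulr_ge0// sqr_ge0.
rewrite -(ler_pM2l Np) -expr2 (le_trans h5)//.
apply: le_trans (ler_pM _ _ h4 h2) _ => //.
by rewrite le_eqVlt; apply/orP; left; apply/eqP; ring.
Qed.

End EuclideanNorm.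

Section OperatorNorm.
Variable R : realType.

(** The Frobenius norm is an explicit bound; without one, the supremum that
    defines opnorm would carry no information. *)
Lemma enorm_mulmx_bounded (m n : nat) (A : 'M[R]_(m, n)) :
  exists c, forall v, enorm (A *m v) <= c * enorm v.
Proof.
pose F := \sum_i dot (row i A)^T (row i A)^T.
have F0 : 0 <= F by apply: sumr_ge0 => i _; exact: dot_ge0.
exists (Num.sqrt F) => v.
rewrite enorm_le ?mulr_ge0 ?sqrtr_ge0 ?enorm_ge0// exprMn sqr_sqrtr//.
rewrite /F mulr_suml /dot; apply: ler_sum => i _.
have -> : (A *m v) i 0 = dot (row i A)^T v.
  by rewrite mxE; apply: eq_bigr => j _; rewrite !mxE.
rewrite -expr2 -/(dot _ _) -sqr_enorm -exprMn -[leLHS]real_normK ?num_real//.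
rewrite ler_pXn2r ?nnegrE ?mulr_ge0 ?enorm_ge0// ler_norml.
rewrite cauchy_schwarz andbT lerNl -mulN1r -dotZl.
by rewrite (le_trans (cauchy_schwarz _ _))// scaleN1r enormN.
Qed.

Lemma opnorm_has_sup (m n : nat) (A : 'M[R]_(m, n)) :
  has_sup [set enorm (A *m v) | v in [set v : 'cV[R]_n | enorm v <= 1]].
Proof.
split; first by exists (enorm (A *m 0)), 0 => //=; rewrite enorm0.
have [c hc] := enorm_mulmx_bounded A.
exists (Num.max 0 c) => _ [v /= v1 <-]; apply: le_trans (hc v) _.
have [c0|c0] := leP 0 c; first by rewrite ler_piMr.
by rewrite mulr_le0_ge0 ?enorm_ge0 ?ltW.
Qed.

Lemma opnorm_ge0 (m n : nat) (A : 'M[R]_(m, n)) : 0 <= opnorm A.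
Proof.
apply: ub_le_sup; first by case: (opnorm_has_sup A).
by exists 0; rewrite /= ?enorm0// mulmx0 enorm0.
Qed.

Lemma enorm_mulmx (m n : nat) (A : 'M[R]_(m, n)) v :
  enorm (A *m v) <= opnorm A * enorm v.
Proof.
have [v0|v0] := eqVneq (enorm v) 0.
  by rewrite (enorm_eq0 v0) mulmx0 !enorm0 mulr0.
have vp : 0 < enorm v by rewrite lt_neqAle eq_sym v0 enorm_ge0.
rewrite -ler_pdivrMr//; apply: ub_le_sup; first by case: (opnorm_has_sup A).
exists ((enorm v)^-1 *: v) => /=.
  by rewrite enormZ ger0_norm ?invr_ge0 ?enorm_ge0// mulVf.
by rewrite -scalemxAr enormZ ger0_norm ?invr_ge0 ?enorm_ge0// mulrC.
Qed.

Lemma opnorm_le (m n : nat) (A : 'M[R]_(m, n)) c : 0 <= c ->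
  (forall v, enorm (A *m v) <= c * enorm v) -> opnorm A <= c.
Proof.
move=> c0 h; apply: ge_sup; first by case: (opnorm_has_sup A).
by move=> _ [v /= v1 <-]; rewrite (le_trans (h v))// ler_piMr.
Qed.

Lemma opnormD (m n : nat) (A B : 'M[R]_(m, n)) :
  opnorm (A + B) <= opnorm A + opnorm B.
Proof.
apply: opnorm_le => [|v]; first by rewrite addr_ge0 ?opnorm_ge0.
by rewrite mulmxDl mulrDl (le_trans (enormD _ _))// lerD ?enorm_mulmx.
Qed.

Lemma opnormM (m n p : nat) (A : 'M[R]_(m, n)) (B : 'M[R]_(n, p)) :
  opnorm (A *m B) <= opnorm A * opnorm B.
Proof.
apply: opnorm_le => [|v]; first by rewrite mulr_ge0 ?opnorm_ge0.
rewrite -mulmxA (le_trans (enorm_mulmx _ _))// -mulrA.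
by rewrite ler_wpM2l ?opnorm_ge0 ?enorm_mulmx.
Qed.

Lemma opnormZ_le (m n : nat) a (A : 'M[R]_(m, n)) :
  opnorm (a *: A) <= `|a| * opnorm A.
Proof.
apply: opnorm_le => [|v]; first by rewrite mulr_ge0 ?opnorm_ge0.
by rewrite -scalemxAl enormZ -mulrA ler_wpM2l ?enorm_mulmx.
Qed.

Lemma enorm_mulmx_le (m n : nat) (A : 'M[R]_(m, n)) v a b :
  opnorm A <= a -> enorm v <= b -> enorm (A *m v) <= a * b.
Proof.
move=> Aa vb; apply: le_trans (enorm_mulmx _ _) _.
by rewrite ler_pM ?opnorm_ge0 ?enorm_ge0.
Qed.

Lemma opnorm_prod (n : nat) (A : nat -> 'M[R]_n) c k :
  (forall i, (1 <= i < k.+1)%N -> opnorm (A i) <= c) ->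
  opnorm (\prod_(1 <= i < k.+1) A i) <= c ^+ k.
Proof.
elim: k => [|k IH] h.
  by rewrite big_nil expr0 opnorm_le// => v; rewrite mul1mx mul1r.
rewrite big_nat_recr//= exprSr -mulmxE (le_trans (opnormM _ _))//.
rewrite ler_pM ?opnorm_ge0 ?h ?ltnSn ?andbT// IH// => i /andP[i1 ik].
by rewrite h// i1 ltnS ltnW.
Qed.

(** Replacing the factors one at a time, each replacement costs e and leaves
    the k - 1 other factors, of norm at most c. *)
Lemma opnorm_prodB (n : nat) (A B : nat -> 'M[R]_n) c e k : 0 <= c -> 0 <= e ->
  (forall i, (1 <= i < k.+1)%N -> opnorm (A i) <= c) ->
  (forall i, (1 <= i < k.+1)%N -> opnorm (B i) <= c) ->
  (forall i, (1 <= i < k.+1)%N -> opnorm (A i - B i) <= e) ->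
  opnorm (\prod_(1 <= i < k.+1) A i - \prod_(1 <= i < k.+1) B i)
    <= k%:R * c ^+ k.-1 * e.
Proof.
move=> c0 e0; elim: k => [|k IH] hA hB hAB.
  rewrite !big_nil subrr !mul0r opnorm_le// => v.
  by rewrite mul0mx mul0r enorm0.
have le_k i : (1 <= i < k.+1)%N -> (1 <= i < k.+2)%N.
  by move=> /andP[-> ik]; rewrite ltnS ltnW.
rewrite [X in X - _]big_nat_recr//= [X in _ - X]big_nat_recr//= -mulmxE.
set PA := \prod_(_ <= _ < _) _; set PB := \prod_(_ <= _ < _) _.
have -> : PA *m A k.+1 - PB *m B k.+1 =
    (PA - PB) *m A k.+1 + PB *m (A k.+1 - B k.+1).
  by rewrite mulmxBl mulmxBr addrA subrK.
apply: le_trans (opnormD _ _) _.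
have -> : k.+1%:R * c ^+ k * e = k%:R * c ^+ k * e + c ^+ k * e.
  by rewrite -natr1 !mulrDl mul1r.
apply: lerD; apply: le_trans (opnormM _ _) _.
  have -> : k%:R * c ^+ k * e = k%:R * c ^+ k.-1 * e * c.
    by case: (k) => [|j]; rewrite ?mul0r//= exprSr; ring.
  rewrite ler_pM ?opnorm_ge0//; last by rewrite hA ?ltnSn.
  by apply: IH => i /le_k; [exact: hA|exact: hB|exact: hAB].
rewrite ler_pM ?opnorm_ge0//; last by rewrite hAB ?ltnSn.
by apply: opnorm_prod => i /le_k; exact: hB.
Qed.

Lemma enorm_col_mx_le (m n : nat) (x : 'cV[R]_m) (y : 'cV[R]_n) :
  enorm (col_mx x y) <= enorm x + enorm y.
Proof.
rewrite enorm_le ?addr_ge0 ?enorm_ge0// /dot big_split_ord/=.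
under eq_bigr do rewrite col_mxEu.
under [X in _ + X]eq_bigr do rewrite col_mxEd.
rewrite -!/(dot _ _) -!sqr_enorm.
have := enorm_ge0 x; have := enorm_ge0 y; nra.
Qed.

End OperatorNorm.

(** * Second derivatives *)

Section Calculus.
Variables (R : realType) (V : normedModType R).
Implicit Types (h F : V -> R) (p q u v : V) (t : R).

Lemma is_derive_line h p v t : differentiable h (t *: v + p) ->
  is_derive t 1 (fun s => h (s *: v + p)) ('D_v h (t *: v + p)).
Proof.
move=> /(@diff_derivable _ _ _ _ _ v) dh.
have E : (fun s : R => s^-1 *: ((h \o shift (t *: v + p)) (s *: v)
             - h (t *: v + p))) =
         (fun s : R => s^-1 *: (((fun s => h (s *: v + p)) \o shift t) s%:A
             - h (t *: v + p))).
  apply/funext => s /=; congr (_ *: (h _ - _)).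
  by rewrite [s%:A]mulr1 scalerDl addrA.
split; first by move: dh; rewrite /derivable E.
by rewrite /derive E.
Qed.

Lemma MVT_line h p v t : 0 < t -> (forall q, differentiable h q) ->
  exists2 a, 0 <= a <= t & h (t *: v + p) - h p = 'D_v h (a *: v + p) * t.
Proof.
move=> t0 dh.
have dl s : is_derive s (1 : R) (fun s => h (s *: v + p)) ('D_v h (s *: v + p)).
  exact: is_derive_line.
have [|a] := @MVT R (fun s => h (s *: v + p)) _ 0 t t0 (fun s _ => dl s).
  apply: derivable_within_continuous => s _.
  by have [] := dl s.
rewrite in_itv/= => /andP[a0 at_] E; exists a; first by rewrite !ltW.
by move: E; rewrite scale0r add0r subr0.
Qed.

Lemma derive_translate h p u v : 'D_u (fun q => h (v + q)) p = 'D_u h (v + p).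
Proof.
have E : (fun s : R => s^-1 *: (((fun q => h (v + q)) \o shift p) (s *: u)
             - h (v + p))) =
         (fun s : R => s^-1 *: ((h \o shift (v + p)) (s *: u) - h (v + p))).
  by apply/funext => s /=; rewrite addrCA.
by rewrite /derive E.
Qed.

(** The second difference over the parallelogram spanned by t u and t v. *)
Definition diff2 h p u v t :=
  (h (t *: v + (t *: u + p)) - h (t *: u + p)) - (h (t *: v + p) - h p).

Lemma diff2C h p u v t : diff2 h p u v t = diff2 h p v u t.
Proof. by rewrite /diff2 (addrCA (t *: u)); ring. Qed.

(** One mean value theorem for q |-> h (q + t v) - h q along u, one for 'D_u h
    along v. *)
Lemma diff2_MVT h p u v t : 0 < t -> (forall q, differentiable h q) ->
  (forall q, differentiable ('D_u h) q) ->
  exists a b, [/\ 0 <= a <= t, 0 <= b <= t &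
    diff2 h p u v t = 'D_v ('D_u h) (b *: v + (a *: u + p)) * t ^+ 2].
Proof.
move=> t0 dh d2h.
pose T := fun q => h (t *: v + q).
have dT q : differentiable T q.
  exact: (@differentiable_comp _ _ _ _ (fun q => t *: v + q) h).
have dH q : differentiable (T - h) q by exact: differentiableB.
have [a a0t E] := MVT_line p u t0 dH.
have [b b0t E2] := MVT_line (a *: u + p) v t0 d2h.
exists a, b; split => //; rewrite expr2 mulrA -E2.
by rewrite -derive_translate -deriveB; [exact: E|exact: diff_derivable..].
Qed.

(** Small parallelograms at p stay in a given neighbourhood.  The coefficients
    may be negative, so that p need not be a corner. *)
Lemma near_parallelogram (P : set V) p u v : nbhs p P ->
  exists2 t, 0 < t & forall a b, `|a| <= t -> `|b| <= t ->
    P (b *: v + (a *: u + p)).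
Proof.
move=> /nbhs_ballP[e /= e0 eP].
have s0 : 0 < `|u| + `|v| + 1 by rewrite ltr_wpDl// addr_ge0.
exists (e / (2 * (`|u| + `|v| + 1))) => [|a b].
  by rewrite divr_gt0// mulr_gt0.
set t := e / _ => ta tb; have t0 : 0 < t by rewrite divr_gt0// mulr_gt0.
apply: eP; rewrite -ball_normE /ball_ /=.
rewrite -normrN opprB addrA addrK (le_lt_trans (ler_normD _ _))// !normrZ.
have tE : t * (2 * (`|u| + `|v| + 1)) = e.
  by rewrite /t divfK// gt_eqF// mulr_gt0.
have : `|b| * `|v| <= t * `|v| by rewrite ler_wpM2r.
have : `|a| * `|u| <= t * `|u| by rewrite ler_wpM2r.
have : 0 <= t * `|u| by rewrite mulr_ge0// ltW.
have : 0 <= t * `|v| by rewrite mulr_ge0// ltW.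
rewrite -tE; lra.
Qed.

Lemma continuous_near F p (e : R) : {for p, continuous F} -> 0 < e ->
  nbhs p [set q | `|F p - F q| < e].
Proof. by move=> cF e0; exact: (cvgr_dist_lt _ _ cF). Qed.

(** Symmetry of second derivatives: the second difference is symmetric in the
    two directions, and the mean value theorem, applied in either order,
    writes it as a mixed derivative at a nearby point. *)
Lemma derive2C h p u v : (forall q, differentiable h q) ->
  (forall w q, differentiable ('D_w h) q) ->
  (forall w w', continuous ('D_w ('D_w' h))) ->
  'D_u ('D_v h) p = 'D_v ('D_u h) p.
Proof.
move=> dh d2h c2h; apply/eqP; rewrite -subr_eq0 -normr_le0.
apply/ler_addgt0Pl => e e0; rewrite addr0.
have e2 : 0 < e / 2 by rewrite divr_gt0.
have [t1 t10 h1] := near_parallelogram u v (continuous_near (c2h v u p) e2).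
have [t2 t20 h2] := near_parallelogram v u (continuous_near (c2h u v p) e2).
pose t := Num.min t1 t2.
have t0 : 0 < t by rewrite lt_min t10.
have [a [b [a0 b0 E]]] := diff2_MVT p v t0 dh (d2h u).
have [a' [b' [a'0 b'0 E']]] := diff2_MVT p u t0 dh (d2h v).
have le1 s : 0 <= s <= t -> `|s| <= t1.
  by move=> /andP[s0 st]; rewrite ger0_norm// (le_trans st)// ge_min lexx.
have le2 s : 0 <= s <= t -> `|s| <= t2.
  by move=> /andP[s0 st]; rewrite ger0_norm// (le_trans st)// ge_min lexx orbT.
have /= H1 := h1 _ _ (le1 _ a0) (le1 _ b0).
have /= H2 := h2 _ _ (le2 _ a'0) (le2 _ b'0).
have tt0 : t ^+ 2 != 0 by rewrite expf_eq0/= gt_eqF.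
move: E; rewrite diff2C E' => /(mulIf tt0) E.
rewrite -E distrC in H1; rewrite (splitr e).
apply: le_trans (ler_distD ('D_u ('D_v h) (b' *: u + (a' *: v + p))) _ _) _.
by apply: lerD; apply: ltW; [exact: H2|exact: H1].
Qed.

(** The symmetric second difference is [diff2] based at p - t v with both
    directions equal to v, hence t^2 times a second derivative near p. *)
Lemma derive2_ge h p v c : (forall q, differentiable h q) ->
  (forall q, differentiable ('D_v h) q) ->
  {for p, continuous ('D_v ('D_v h))} ->
  (forall t, 0 < t -> c * t ^+ 2 <= h (p + t *: v) + h (p - t *: v) - 2 * h p) ->
  c <= 'D_v ('D_v h) p.
Proof.
move=> dh d2h c2h hc; apply/ler_addgt0Pr => e e0.
have [t t0 ht] := near_parallelogram v v (continuous_near c2h e0).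
have [a [b [a0 b0 E]]] := diff2_MVT (p - t *: v) v t0 dh d2h.
have := hc _ t0.
have <- : diff2 h (p - t *: v) v v t
    = h (p + t *: v) + h (p - t *: v) - 2 * h p.
  by rewrite /diff2 (addrCA _ p) subrr addr0 (addrC _ p); ring.
rewrite E ler_pM2r ?exprn_gt0// => /le_trans; apply.
have -> : a *: v + (p - t *: v) = (a - t) *: v + p.
  by rewrite scalerBl addrCA addrC.
case/andP: a0 => a0 a1; case/andP: b0 => b0 b1.
have /= H : `|'D_v ('D_v h) p - 'D_v ('D_v h) (b *: v + ((a - t) *: v + p))| < e.
  apply: ht; last by rewrite ger0_norm.
  by rewrite ler0_norm ?subr_le0// opprB lerBlDr lerDl.
exact: ltW (ltr_distlCDr H).
Qed.

Lemma derive_le F p v c : derivable F p v ->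
  (forall t, 0 < t -> F (p + t *: v) - F p <= c * t) -> 'D_v F p <= c.
Proof.
move=> dF hc; apply: cvgr_to_le (cvg_dnbhs_at_right dF) _.
near=> t; have t0 : 0 < t by [].
by rewrite /= [_ *: _]mulrC ler_pdivrMr// [t *: v + p]addrC hc.
Unshelve. all: by end_near. Qed.

End Calculus.

(** * Quadratic form of the lower-level Hessian *)

Section PairCalculus.
Variables (R : realType) (m n : nat).
Implicit Types (h : 'cV[R]_m * 'cV[R]_n -> R) (p : 'cV[R]_m * 'cV[R]_n).
Implicit Types v : 'cV[R]_n.

Definition incy v : 'cV[R]_m * 'cV[R]_n := (0, v).

Lemma incy_sum v : incy v = \sum_j v j 0 *: evy R m j.
Proof.
have incyD : {morph incy : x y / x + y}.
  by move=> x y; rewrite /incy; congr pair; rewrite addr0.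
rewrite {1}[v]matrix_sum_delta (big_morph incy incyD (erefl (0, 0))).
apply: eq_bigr => j _; rewrite big_ord1 /incy /evy.
by congr pair; rewrite /= scaler0.
Qed.

Lemma derive_incy h p v : differentiable h p ->
  'D_(incy v) h p = dot v (grady h p).
Proof.
move=> dh; rewrite deriveE// incy_sum linear_sum.
by apply: eq_bigr => j _; rewrite linearZ mxE -deriveE.
Qed.

Lemma derive2_incy h p v : twice_continuously_differentiable h ->
  'D_(incy v) ('D_(incy v) h) p = dot v (hessyy h p *m v).
Proof.
move=> [dh d2h _].
have -> : 'D_(incy v) h = \sum_j (v j 0 *: 'D_(evy R m j) h).
  apply/funext => q; rewrite derive_incy// fct_sumE.
  by apply: eq_bigr => j _; rewrite mxE.
rewrite derive_sum => [|j]; last by apply/derivableZ/diff_derivable/d2h.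
rewrite dot_trmx dotC; apply: eq_bigr => j _.
rewrite deriveZ; last exact/diff_derivable/d2h.
congr (_ * _); rewrite derive_incy; last exact: d2h.
by rewrite mxE; apply: eq_bigr => i _; rewrite !mxE mulrC.
Qed.

Lemma hessyy_sym h p : twice_continuously_differentiable h ->
  (hessyy h p)^T = hessyy h p.
Proof.
move=> [dh d2h c2h]; apply/matrixP => i j; rewrite !mxE.
exact: derive2C.
Qed.

(** Strong convexity at the midpoint of p.2 + t v and p.2 - t v bounds the
    symmetric second difference of h from below. *)
Lemma hessyy_ge h mu p v : twice_continuously_differentiable h ->
  (forall x, strongly_convex mu (fun y => h (x, y))) ->
  mu * dot v v <= dot v (hessyy h p *m v).
Proof.
move=> C2 cvx; rewrite -derive2_incy//; have [dh d2h c2h] := C2.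
apply: derive2_ge => // [|t t0]; first exact: c2h.
have h01 : 0 <= (2^-1 : R) <= 1 by apply/andP; split; lra.
have := cvx p.1 (p.2 + t *: v) (p.2 - t *: v) 2^-1 h01.
have -> : 1 - 2^-1 = 2^-1 :> R by field.
have -> : 2^-1 *: (p.2 + t *: v) + 2^-1 *: (p.2 - t *: v) = p.2.
  rewrite -scalerDr addrACA subrr addr0 -mulr2n -[p.2 *+ 2]scaler_nat scalerA.
  by rewrite mulVf ?pnatr_eq0// scale1r.
have -> : p.2 + t *: v - (p.2 - t *: v) = (2 * t) *: v.
  by rewrite opprB addrC addrA subrK -mulr2n -[t *: v *+ 2]scaler_nat scalerA.
rewrite sqr_enorm dotZl dotZr.
have -> : p + t *: incy v = (p.1, p.2 + t *: v).
  by rewrite /incy; case: p => a b; congr pair; rewrite /= scaler0 addr0.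
have -> : p - t *: incy v = (p.1, p.2 - t *: v).
  by rewrite /incy; case: p => a b; congr pair; rewrite /= scaler0 subr0.
rewrite -surjective_pairing; nra.
Qed.

(** The slope of t |-> <v, grady h (p + t v)> is at most L |v|^2. *)
Lemma hessyy_le h L p v : 0 <= L -> twice_continuously_differentiable h ->
  lipschitz_wrt (@enorm R n) L (grady h) ->
  dot v (hessyy h p *m v) <= L * dot v v.
Proof.
move=> L0 C2 lip; rewrite -derive2_incy//; have [dh d2h c2h] := C2.
apply: derive_le => [|t t0]; first exact: diff_derivable.
rewrite !derive_incy// -dotBr.
apply: le_trans (cauchy_schwarz _ _) _.
apply: le_trans (ler_wpM2l (enorm_ge0 _) (lip _ _)) _.
have -> : (p + t *: incy v).1 - p.1 = 0.
  by rewrite /= scaler0 addr0 subrr.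
have -> : (p + t *: incy v).2 - p.2 = t *: v.
  by rewrite /= addrC addKr.
have v0 := enorm_ge0 v; have := enorm_col_mx_le (0 : 'cV[R]_m) (t *: v).
rewrite enorm0 add0r enormZ gtr0_norm// => tv.
have {}tv := ler_wpM2l (enorm_ge0 v) (ler_wpM2l L0 tv).
apply: le_trans tv _.
by rewrite -sqr_enorm le_eqVlt; apply/orP; left; apply/eqP; ring.
Qed.

(** By strong convexity and the Lipschitz bound on the gradient, the spectrum
    of the symmetric matrix hessyy h p lies in [mu, L]. *)
Lemma opnorm_sub_hessyy h L mu p : 0 < mu -> mu < L ->
  twice_continuously_differentiable h ->
  lipschitz_wrt (@enorm R n) L (grady h) ->
  (forall x, strongly_convex mu (fun y => h (x, y))) ->
  opnorm (1%:M - L^-1 *: hessyy h p) <= 1 - mu / L.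
Proof.
move=> mu0 muL C2 lip cvx.
have L0 : 0 < L by apply: lt_trans muL.
have r0 : 0 <= 1 - mu / L by rewrite subr_ge0 ler_pdivrMr// mul1r ltW.
apply: opnorm_le => // v; apply: sym_enorm_mulmx => //.
  by rewrite linearB/= trmx1 linearZ/= hessyy_sym.
move=> w; rewrite mulmxBl mul1mx -scalemxAl dotBr dotZr.
have := hessyy_ge p w C2 cvx; have := hessyy_le p w (ltW L0) C2 lip.
set q := dot w (_ *m w) => qL qmu; apply/andP; split.
  by rewrite subr_ge0 mulrC ler_pdivrMr// mulrC.
by rewrite mulrBl mul1r lerD2l lerN2 mulrAC [leRHS]mulrC ler_pM2r// invr_gt0.
Qed.

End PairCalculus.

(** * Supports and nonmeasurable integrands *)

(** A point outside the support has a null neighbourhood, hence lies in a null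
    member of the countable basis. *)
Lemma negligible_setC_supp (R : realType) (T : ptopologicalType)
    (mu : probability (borel T) R) :
  @second_countable T -> mu.-negligible (~` supp mu : set (borel T)).
Proof.
move=> [B cB [Bo Bbasis]]; have /countable_injP[f f_inj] := cB.
have mopen U : open U -> measurable (U : set (borel T)).
  by move=> oU; exact: sub_sigma_algebra.
(* f numbers the basis, so null n is either empty or the n-th basic set. *)
pose null n := [set x : borel T |
  exists U : set T, [/\ B U, mu U = 0%E, f U = n & U x]].
apply: (@negligibleS _ _ _ mu (\bigcup_n null n)); last first.
  apply: negligible_bigcup => n.
  have [[U [BU U0 fU]]|noU] :=
    pselect (exists U : set T, [/\ B U, mu U = 0%E & f U = n]).
    apply: (@negligibleS _ _ _ mu (U : set (borel T))); last first.
      by apply/negligibleP => //; apply: mopen; exact: Bo.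
    move=> x [U' [BU' U'0 fU' U'x]].
    suff -> : U = U' by [].
    by apply: f_inj; rewrite ?inE// fU fU'.
  apply: negligibleS (negligible_set0 mu) => x [U [BU U0 fU Ux]].
  by apply: noU; exists U.
move=> x /existsNP[U] /not_implyP[oU] /not_implyP[Ux U0].
have /(Bbasis x)[W [BW Wx] WU] : nbhs x U by exact: open_nbhs_nbhs.
exists (f W) => //; exists W; split=> //.
apply/eqP; rewrite -measure_le0; apply: (@le_trans _ _ (mu U)).
  by apply: le_measure => //; rewrite inE; apply: mopen => //; exact: Bo.
by rewrite leNgt; apply/negP.
Qed.

Lemma ae_supp (R : realType) (T : ptopologicalType)
    (mu : probability (borel T) R) (d : measure_display)
    (Omega : measurableType d) (P : probability Omega R)
    (X : {RV P >-> borel T}) :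
  @second_countable T ->
  (forall A : set (borel T), measurable A -> distribution P X A = mu A) ->
  {ae P, forall w, supp mu (X w)}.
Proof.
move=> /(negligible_setC_supp mu)[N [mN N0 suppN]] lawX.
exists (X @^-1` N); split; first exact: measurable_funPTI.
  by have := lawX _ mN; rewrite N0.
by move=> w /= /suppN.
Qed.

(** The K values 0, .., K - 1 already carry the whole mass. *)
Lemma ae_lt_uniform (R : realType) (K : nat) (d : measure_display)
    (Omega : measurableType d) (P : probability Omega R) (k : {RV P >-> nat}) :
  (0 < K)%N ->
  (forall j : nat, (j < K)%N -> distribution P k [set j] = (K%:R^-1)%:E) ->
  {ae P, forall w, (k w < K)%N}.
Proof.
move=> K0 lawk.
have mk (A : set nat) : measurable (k @^-1` A) by exact: measurable_funPTI.
have E : P (\big[setU/set0]_(j < K) (k @^-1` [set val j])) = 1%E.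
  rewrite measure_bigsetU_ord//; last first.
    apply/trivIsetP => i j _ _ /eqP ij; apply/seteqP; split => // w [/= ki kj].
    by apply: ij; apply: val_inj; exact: etrans (esym ki) kj.
  rewrite (eq_bigr (fun=> (K%:R^-1)%:E)) => [|j _]; last exact: (lawk j (ltn_ord j)).
  by rewrite sumEFin sumr_const card_ord -[_ *+ _]mulr_natr mulVf// pnatr_eq0 -lt0n.
exists (~` (\big[setU/set0]_(j < K) (k @^-1` [set val j]))); split.
- by apply: measurableC; apply: bigsetU_measurable.
- by rewrite probability_setC ?E ?subee//; apply: bigsetU_measurable.
- move=> w /= kw; rewrite -(bigcup_mkord K (fun j => k @^-1` [set j])).
  by move=> -[j /= jK kj]; apply: kw; rewrite kj.
Qed.

Section NonmeasurableIntegrand.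
Import HBNNSimple.

(** The integral of a nonnegative function is defined as a supremum over the
    simple functions below it, so f itself need not be measurable. *)
Lemma ae_le_integral (d : measure_display) (T : measurableType d)
    (R : realType) (mu : {measure set T -> \bar R}) (f h : T -> \bar R) :
  (forall x, (0 <= f x)%E) -> (forall x, (0 <= h x)%E) ->
  measurable_fun setT h -> {ae mu, forall x, (f x <= h x)%E} ->
  (\int[mu]_x f x <= \int[mu]_x h x)%E.
Proof.
move=> f0 h0 mh fh; rewrite (ge0_integralTE mu f0).
apply: ge_ereal_sup => _ [s /= sf <-]; rewrite -integralT_nnsfun.
apply: ae_ge0_le_integral => //.
- by move=> x _; rewrite lee_fin.
- by apply/measurable_EFinP; exact: measurable_funP.
- by apply: filterS fh => x fx _; exact: le_trans (sf x) fx.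
Qed.

End NonmeasurableIntegrand.

(** The majorant sum_(j < K) c j 1_(k = j) is measurable whatever X is. *)
Lemma expectation_le_uniform (R : realType) (K : nat) (d : measure_display)
    (Omega : measurableType d) (P : probability Omega R) (k : {RV P >-> nat})
    (X : Omega -> R) (c : nat -> R) :
  (0 < K)%N ->
  (forall j : nat, (j < K)%N -> distribution P k [set j] = (K%:R^-1)%:E) ->
  (forall w, 0 <= X w) -> (forall j, 0 <= c j) ->
  {ae P, forall w, X w <= c (k w)} ->
  ('E_P[X] <= (K%:R^-1 * \sum_(j < K) c j)%:E)%E.
Proof.
move=> K0 lawk X0 c0 Xc; rewrite unlock.
have mk (A : set nat) : measurable (k @^-1` A) by exact: measurable_funPTI.
pose h w := (\sum_(j < K) (c j)%:E * (\1_(k @^-1` [set val j]) w : R)%:E)%E.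
have mind (j : 'I_K) : measurable_fun setT
    (fun w => (\1_(k @^-1` [set val j]) w : R)%:E).
  by apply/measurable_EFinP; exact: measurable_indic.
have mterm (j : 'I_K) : measurable_fun setT
    (fun w => ((c j)%:E * (\1_(k @^-1` [set val j]) w : R)%:E)%E).
  by apply: emeasurable_funM => //; exact: measurable_cst.
have t0 (j : 'I_K) w : (0 <= (c j)%:E * (\1_(k @^-1` [set val j]) w : R)%:E)%E.
  by rewrite -EFinM lee_fin mulr_ge0.
apply: (@le_trans _ _ (\int[P]_w h w)%E).
  apply: ae_le_integral => [w|w||].
  - by rewrite lee_fin.
  - by apply: sume_ge0.
  - by apply: emeasurable_sum.
  apply: filterS2 Xc (ae_lt_uniform K0 lawk) => w Xw kw.
  rewrite /h (bigD1 (Ordinal kw))//= indicE mem_set// mule1.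
  by rewrite (@le_trans _ _ (c (k w))%:E) ?lee_fin// leeDl// sume_ge0.
rewrite ge0_integral_sum// mulr_sumr -sumEFin le_eqVlt; apply/orP; left.
apply/eqP/eq_bigr => j _; rewrite ge0_integralZl_EFin//.
rewrite integral_indic// setIT mulrC EFinM; congr (_ * _)%E.
exact: (lawk j (ltn_ord j)).
Qed.

(** * Pathwise Lipschitz bound *)

(** A squared Lipschitz constant of the estimator when k = j. *)
Definition pathwise_lip2 (R : realType) (K : nat)
    (Lfx Lfy Cfy Lg mug Lgxy Lgyy Cgxy : R) (j : nat) : R :=
  let r := 1 - mug / Lg in
  2 * Lfx ^+ 2 + 6 * (K%:R / Lg) ^+ 2 *
    ((Cgxy ^+ 2 * Lfy ^+ 2 + Cfy ^+ 2 * Lgxy ^+ 2) * (r ^+ j) ^+ 2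
     + Cgxy ^+ 2 * Cfy ^+ 2 * Lgyy ^+ 2 / Lg ^+ 2 * (j%:R * r ^+ j.-1) ^+ 2).

Lemma pathwise_lip2_ge0 (R : realType) (K : nat)
    (Lfx Lfy Cfy Lg mug Lgxy Lgyy Cgxy : R) (j : nat) :
  0 <= pathwise_lip2 K Lfx Lfy Cfy Lg mug Lgxy Lgyy Cgxy j.
Proof.
rewrite /pathwise_lip2.
by do ?[exact: sqr_ge0 | apply: addr_ge0 | apply: mulr_ge0 | rewrite invr_ge0].
Qed.

Section TripleProduct.
Variables (R : realType) (m n : nat).

Lemma sqr_enorm_subZ_le (a1 a2 u1 u2 : 'cV[R]_m) kap X Y : 0 <= kap ->
  enorm (a1 - a2) <= X -> enorm (u1 - u2) ^+ 2 <= Y ->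
  enorm (a1 - kap *: u1 - (a2 - kap *: u2)) ^+ 2
    <= 2 * X ^+ 2 + 2 * (kap ^+ 2 * Y).
Proof.
move=> kap0 hX hY.
have -> : a1 - kap *: u1 - (a2 - kap *: u2) = (a1 - a2) - kap *: (u1 - u2).
  by rewrite scalerBr !opprD !opprK addrACA.
have := enormD (a1 - a2) (- (kap *: (u1 - u2))).
rewrite enormN enormZ ger0_norm//.
move: (enorm_ge0 (a1 - a2 - kap *: (u1 - u2))).
move: (enorm_ge0 (a1 - a2)) (enorm_ge0 (u1 - u2)) hX hY.
move: (enorm (_ - _ *: _)) (enorm (a1 - a2)) (enorm (u1 - u2)) => N b c.
move=> b0 c0 bX cY N0 hN.
apply: (@le_trans _ _ ((b + kap * c) ^+ 2)).
  by rewrite ler_pXn2r// nnegrE addr_ge0// mulr_ge0.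
have bX2 : b ^+ 2 <= X ^+ 2 by rewrite ler_pXn2r// nnegrE (le_trans b0).
have := ler_wpM2l (sqr_ge0 kap) cY.
by have := sqr_ge0 (b - kap * c); move: bX2; rewrite !expr2; lra.
Qed.

(** Telescoping: H1 M1 b1 - H2 M2 b2 is
    H1 M1 (b1 - b2) + H1 (M1 - M2) b2 + (H1 - H2) M2 b2. *)
Lemma sqr_enorm_mulmxB_le (H1 H2 : 'M[R]_(m, n)) (M1 M2 : 'M[R]_n)
    (b1 b2 : 'cV[R]_n) CH CM Cb eH eM eb :
  opnorm H1 <= CH -> opnorm M1 <= CM -> opnorm M2 <= CM -> enorm b2 <= Cb ->
  opnorm (H1 - H2) <= eH -> opnorm (M1 - M2) <= eM -> enorm (b1 - b2) <= eb ->
  enorm (H1 *m M1 *m b1 - H2 *m M2 *m b2) ^+ 2 <=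
    3 * ((CH * (CM * eb)) ^+ 2 + (CH * (eM * Cb)) ^+ 2 + (eH * (CM * Cb)) ^+ 2).
Proof.
move=> hH1 hM1 hM2 hb2 hH hM hb.
have -> : H1 *m M1 *m b1 - H2 *m M2 *m b2 = H1 *m (M1 *m (b1 - b2))
    + H1 *m ((M1 - M2) *m b2) + (H1 - H2) *m (M2 *m b2).
  by rewrite !mulmxBl !mulmxBr !mulmxA !subrKA.
set u1 := H1 *m (M1 *m _); set u2 := H1 *m (_ *m b2); set u3 := _ *m (M2 *m b2).
have h1 : enorm u1 <= CH * (CM * eb) by do 2?apply: enorm_mulmx_le.
have h2 : enorm u2 <= CH * (eM * Cb) by do 2?apply: enorm_mulmx_le.
have h3 : enorm u3 <= eH * (CM * Cb) by do 2?apply: enorm_mulmx_le.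
have hN : enorm (u1 + u2 + u3) <= enorm u1 + enorm u2 + enorm u3.
  by rewrite (le_trans (enormD _ _))// lerD2r enormD.
move: (enorm_ge0 (u1 + u2 + u3)) (enorm_ge0 u1) (enorm_ge0 u2) (enorm_ge0 u3).
move: (enorm (u1 + u2 + u3)) (enorm u1) (enorm u2) (enorm u3) hN h1 h2 h3.
move=> N x1 x2 x3 hN h1 h2 h3 N0 x10 x20 x30.
have sq (x y : R) : 0 <= x -> x <= y -> x ^+ 2 <= y ^+ 2.
  by move=> x_ge0 xy; rewrite ler_pXn2r// nnegrE// (le_trans x_ge0).
apply: (le_trans (sq _ _ N0 hN)).
apply: (@le_trans _ _ (3 * (x1 ^+ 2 + x2 ^+ 2 + x3 ^+ 2))); last first.
  by rewrite ler_pM2l ?ltr0n// !lerD// sq.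
have := sqr_ge0 (x1 - x2); have := sqr_ge0 (x2 - x3).
have := sqr_ge0 (x1 - x3); rewrite !expr2; lra.
Qed.

End TripleProduct.

Section StochasticGradient.
Variables (R : realType) (m n : nat).
Local Notation dist p q := (enorm (col_mx (p.1 - q.1) (p.2 - q.2))).

(** The factors 2 and 6 of [pathwise_lip2] come from
    |a + b|^2 <= 2 |a|^2 + 2 |b|^2 and |a + b + c|^2 <= 3 (|a|^2 + |b|^2 + |c|^2). *)
Lemma stochastic_gradient_lipschitz (Xi Z : Type) (K : nat)
    (f : Xi -> 'cV[R]_m * 'cV[R]_n -> R) (g : Z -> 'cV[R]_m * 'cV[R]_n -> R)
    (Lfx Lfy Cfy Lg mug Lgxy Lgyy Cgxy : R) (xi : Xi) (zeta : 'I_K.+1 -> Z)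
    (j : nat) p q :
  0 < mug -> mug < Lg -> 0 <= Lgyy ->
  upper_level_assumption Lfx Lfy Cfy (f xi) ->
  (forall i, lower_level_assumption Lg mug Lgxy Lgyy Cgxy (g (zeta i))) ->
  enorm (stochastic_gradient Lg f g p xi zeta j
         - stochastic_gradient Lg f g q xi zeta j) ^+ 2
    <= pathwise_lip2 K Lfx Lfy Cfy Lg mug Lgxy Lgyy Cgxy j * dist p q ^+ 2.
Proof.
move=> mu0 muL Lgyy0 fP gP; have L0 : 0 < Lg := lt_trans mu0 muL.
have D0 := enorm_ge0 (col_mx (p.1 - q.1) (p.2 - q.2)).
have [_ lipx lipy bdy] := fP; have [_ _ _ lipH _ bdH] := gP ord0.
have {lipx}dx := lipx p q; have {lipy}dy := lipy p q; have {lipH}dH := lipH p q.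
rewrite /pathwise_lip2; set D := enorm (col_mx _ _) in D0 dx dy dH *.
set r := 1 - mug / Lg; have r0 : 0 <= r.
  by rewrite subr_ge0 ler_pdivrMr// mul1r ltW.
pose A s i := 1%:M - Lg^-1 *: hessyy (g (zeta (inord i))) s.
have hA s i : (1 <= i < j.+1)%N -> opnorm (A s i) <= r.
  by move=> _; have [C2 lip cvx _ _ _] := gP (inord i); exact: opnorm_sub_hessyy.
have hAB i : (1 <= i < j.+1)%N -> opnorm (A p i - A q i) <= Lg^-1 * (Lgyy * D).
  move=> _; have [_ _ _ _ lip _] := gP (inord i).
  have -> : A p i - A q i = - Lg^-1 *: (hessyy (g (zeta (inord i))) p
                                      - hessyy (g (zeta (inord i))) q).
    by rewrite /A opprB addrC addrA subrK scaleNr -scalerN opprB scalerBr.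
  apply: le_trans (opnormZ_le _ _) _.
  by rewrite normrN gtr0_norm ?invr_gt0// ler_pM2l ?invr_gt0// lip.
have e0 : 0 <= Lg^-1 * (Lgyy * D) by rewrite !mulr_ge0 ?invr_ge0// ltW.
have := sqr_enorm_mulmxB_le (bdH p) (opnorm_prod (hA p)) (opnorm_prod (hA q))
  (bdy q) dH (opnorm_prodB r0 e0 (hA p) (hA q) hAB) dy.
move=> hUV; have kap0 : 0 <= K%:R / Lg by rewrite divr_ge0// ltW.
apply: le_trans (sqr_enorm_subZ_le kap0 dx hUV) _.
rewrite le_eqVlt; apply/orP; left; apply/eqP.
move: (r ^+ j) (r ^+ j.-1) (j%:R : R) => s t N.
by field; rewrite gt_eqF.
Qed.

End StochasticGradient.

(** * Average over the truncation level *)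

Lemma sum_geometric_le (R : realType) (x : R) (K : nat) : 0 <= x < 1 ->
  \sum_(j < K) x ^+ j <= (1 - x)^-1.
Proof.
move=> /andP[x0 x1]; have y0 : 0 < 1 - x by rewrite subr_gt0.
rewrite -(ler_pM2l y0) mulfV ?gt_eqF// -opprB mulNr -subrX1 opprB.
by rewrite gerBl exprn_ge0.
Qed.

(** With r = 1 - mug / Lg, 1 - r^2 = (2 mug Lg - mug^2) / Lg^2 gives the
    denominators of LK, and j^2 r^(2j - 2) <= (K / r)^2 r^(2j) the factor
    K^3 / (Lg - mug)^2 of its last term. *)
Lemma mean_pathwise_lip2_le (R : realType) (K : nat)
    (Lfx Lfy Cfy Lg mug Lgxy Lgyy Cgxy : R) :
  0 < mug -> mug < Lg -> (0 < K)%N ->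
  K%:R^-1 * \sum_(j < K) pathwise_lip2 K Lfx Lfy Cfy Lg mug Lgxy Lgyy Cgxy j
    <= LK K Lfx Lfy Cfy Lg mug Lgxy Lgyy Cgxy ^+ 2.
Proof.
move=> mu0 muL K0.
have L0 : 0 < Lg := lt_trans mu0 muL.
have d0 : 0 < Lg - mug by rewrite subr_gt0.
have q0 : 0 < 2 * mug * Lg - mug ^+ 2.
  by have := mulr_gt0 mu0 d0; have := mulr_gt0 mu0 L0; lra.
have k0 : 0 < K%:R :> R by rewrite ltr0n.
rewrite sqr_sqrtr; last first.
  by do ?[exact: sqr_ge0 | exact: exprn_ge0 | exact: ltW | apply: addr_ge0
         | apply: mulr_ge0 | rewrite invr_ge0].
rewrite /pathwise_lip2; set r := 1 - mug / Lg.
have rE : r = (Lg - mug) / Lg by rewrite /r; field; rewrite gt_eqF.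
have r0 : 0 < r by rewrite rE divr_gt0.
have r1 : r < 1 by rewrite /r gtrBl divr_gt0.
set S := \sum_(j < K) (r ^+ j) ^+ 2.
have S0 : 0 <= S by apply: sumr_ge0 => j _; rewrite sqr_ge0.
have SE : S <= Lg ^+ 2 / (2 * mug * Lg - mug ^+ 2).
  have -> : Lg ^+ 2 / (2 * mug * Lg - mug ^+ 2) = (1 - r ^+ 2)^-1.
    by rewrite rE; field; rewrite !gt_eqF//=; lra.
  rewrite /S; under eq_bigr do rewrite exprAC.
  by apply: sum_geometric_le; rewrite sqr_ge0 expr_lt1// ltW.
have TE : \sum_(j < K) (j%:R * r ^+ j.-1) ^+ 2 <= K%:R ^+ 2 / r ^+ 2 * S.
  rewrite mulr_sumr; apply: ler_sum => -[[|j] jK] _ /=.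
    by rewrite mul0r expr0n/= !mulr_ge0 ?sqr_ge0// invr_ge0 sqr_ge0.
  rewrite exprMn [r ^+ j.+1]exprS [(r * _) ^+ 2]exprMn.
  rewrite -mulrA [(r ^+ 2)^-1 * _]mulKf ?expf_eq0 ?gt_eqF//.
  by rewrite ler_wpM2r ?sqr_ge0// ler_pXn2r ?nnegrE// ler_nat ltnW.
rewrite big_split sumr_const card_ord/= -mulr_sumr big_split/= -!mulr_sumr.
rewrite -/S; set T := \sum_(j < K) _ in TE *.
set a := Cgxy ^+ 2 * Lfy ^+ 2 + _; set b := Cgxy ^+ 2 * _ * _ / _.
set G := Lg ^+ 2 / _ in SE.
have a0 : 0 <= a.
  by do ?[exact: sqr_ge0 | apply: addr_ge0 | apply: mulr_ge0].
have b0 : 0 <= b.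
  by do ?[exact: sqr_ge0 | apply: divr_ge0 | apply: mulr_ge0].
have {}TE : T <= K%:R ^+ 2 / r ^+ 2 * G.
  by apply: le_trans TE _; rewrite ler_wpM2l// divr_ge0// sqr_ge0.
apply: (@le_trans _ _ (2 * Lfx ^+ 2
  + 6 * (K%:R / Lg ^+ 2) * (a * G + b * (K%:R ^+ 2 / r ^+ 2 * G)))).
  have -> : K%:R^-1 * (2 * Lfx ^+ 2 *+ K + 6 * (K%:R / Lg) ^+ 2 * (a * S + b * T))
      = 2 * Lfx ^+ 2 + 6 * (K%:R / Lg ^+ 2) * (a * S + b * T).
    by rewrite -[_ *+ K]mulr_natr; field; rewrite !gt_eqF.
  rewrite lerD2l ler_wpM2l//.
    by rewrite mulr_ge0// divr_ge0// sqr_ge0.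
  by rewrite lerD// ler_wpM2l.
rewrite le_eqVlt; apply/orP; left; apply/eqP.
by rewrite /a /b /G rE; field; rewrite !gt_eqF.
Qed.

Theorem lemma3p1 (R : realType) (dup dlo : nat)
  (Xi Z : ptopologicalType)
  (Xi_sc : @second_countable Xi) (Z_sc : @second_countable Z)
  (pif : probability (borel Xi) R) (pig : probability (borel Z) R)
  (f : Xi -> 'cV[R]_dup * 'cV[R]_dlo -> R)
  (g : Z -> 'cV[R]_dup * 'cV[R]_dlo -> R)
  (f_int : forall p, pif.-integrable setT (fun xi : borel Xi => (f xi p)%:E))
  (g_int : forall p, pig.-integrable setT (fun zeta : borel Z => (g zeta p)%:E))
  (Lfx Lfy Cfy Lg mug Lgxy Lgyy Cgxy : R)
  (Lfx_ge0 : 0 <= Lfx) (Lfy_ge0 : 0 <= Lfy)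
  (mug_gt0 : 0 < mug) (mug_lt_Lg : mug < Lg)
  (Lgxy_ge0 : 0 <= Lgxy) (Lgyy_ge0 : 0 <= Lgyy) (Cgxy_gt0 : 0 < Cgxy)
  (assumption1 : upper_level_assumption Lfx Lfy Cfy (mean pif f))
  (assumption2 : lower_level_assumption Lg mug Lgxy Lgyy Cgxy (mean pig g))
  (assumption3_f : forall xi, supp pif xi ->
    upper_level_assumption Lfx Lfy Cfy (f xi))
  (assumption3_g : forall zeta, supp pig zeta ->
    lower_level_assumption Lg mug Lgxy Lgyy Cgxy (g zeta))
  (K : nat) (K_ge1 : (1 <= K)%N)
  (d : measure_display) (Omega : measurableType d) (P : probability Omega R)
  (xi : {RV P >-> borel Xi}) (zeta : 'I_K.+1 -> {RV P >-> borel Z})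
  (k : {RV P >-> nat}) (samples : sampling pif pig xi zeta k)
  (x1 x2 : 'cV[R]_dup) (y1 y2 : 'cV[R]_dlo) :
  ('E_P[fun w =>
      (enorm (stochastic_gradient Lg f g (x1, y1) (xi w) (fun i => zeta i w) (k w)
           - stochastic_gradient Lg f g (x2, y2) (xi w) (fun i => zeta i w) (k w))
      ^+ 2)%R]
   <= (LK K Lfx Lfy Cfy Lg mug Lgxy Lgyy Cgxy ^+ 2
       * (enorm (x1 - x2) + enorm (y1 - y2)) ^+ 2)%:E)%E.
Proof.
have [law_xi law_zeta law_k _] := samples.
set p := (x1, y1); set q := (x2, y2).
pose D := enorm (col_mx (p.1 - q.1) (p.2 - q.2)).
pose c j := pathwise_lip2 K Lfx Lfy Cfy Lg mug Lgxy Lgyy Cgxy j * D ^+ 2.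
have ae_zeta : {ae P, forall w, forall i, supp pig (zeta i w)}.
  by apply: filter_forall => i; apply: ae_supp => //; exact: law_zeta.
apply: (@le_trans _ _ (K%:R^-1 * \sum_(j < K) c j)%:E).
  apply: expectation_le_uniform law_k _ _ _ => // [w|j|].
  - exact: sqr_ge0.
  - by rewrite mulr_ge0 ?sqr_ge0 ?pathwise_lip2_ge0.
  apply: filterS2 (ae_supp Xi_sc law_xi) ae_zeta => w xiw zetaw.
  apply: stochastic_gradient_lipschitz => //; first exact: assumption3_f.
  by move=> i; exact: assumption3_g.
rewrite lee_fin -mulr_suml mulrA ler_pM ?mean_pathwise_lip2_le ?sqr_ge0//.
  by rewrite mulr_ge0 ?invr_ge0// sumr_ge0// => j _; exact: pathwise_lip2_ge0.
by rewrite ler_pXn2r ?nnegrE ?addr_ge0 ?enorm_ge0// enorm_col_mx_le.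
Qed.
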